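(* Let $(X,d_X)$ be a compact metric space, $k\ge2$, and let $T:\mathbb{Z}_+^k\to C^0(X,X)$ be a continuous $\mathbb{Z}_+^k$-action with generators $\{T_i:1\le i\le k\}$. If the ball dimension of $X$ is finite, i.e. $D(X)<\infty$, and each $T_i:X\to X$ is Lipschitz with Lipschitz constant $L(T_i)$, then $$h(T)\le\log\sum_{i=1}^{k}L_+(T_i)^{D(X)},\qquad\text{where } L_+(T_i)=\max\{1,L(T_i)\}.$$ In particular, if $X$ is an $m$-dimensional compact Riemannian manifold and each $T_i$, $1\le i\le k$, is differentiable, then $$h(T)\le\log\sum_{i=1}^{k}\max\Bigl\{1,\ \sup_{x\in X}\|d_xT_i\|^m\Bigr\}.$$
   Context: $\mathbb{Z}_+=\{0,1,2,\dots\}$. $C^0(X,X)$ is the set of continuous maps $X\to X$. A continuous $\mathbb{Z}_+^k$-action on $X$ is a monoid homomorphism $T:\mathbb{Z}_+^k\to C^0(X,X)$; its generators are the (commuting) maps $T_i=T(0,\dots,0,1,0,\dots,0)$ with $1$ in the $i$-th place, $1\le i\le k$. Ball dimension: for a compact metric space $X$, let $b(\varepsilon)$ be the minimum cardinality of a covering of $X$ by $\varepsilon$-balls; then $$D(X)=\limsup_{\varepsilon\to0}\frac{\log b(\varepsilon)}{|\log\varepsilon|}\in\mathbb{R}\cup\{\infty\}.$$ Friedland's entropy: the orbit space of $T$ is $$X_T=\Bigl\{\{x_n\}_{n\in\mathbb{Z}_+}\in\prod_{n\in\mathbb{Z}_+}X:\ \text{for every } n\in\mathbb{Z}_+ \text{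 there is } i_n\in\{1,\dots,k\} \text{ with } T_{i_n}(x_n)=x_{n+1}\Bigr\},$$ a compact space with metric $d_{X_T}(\bar x,\bar y)=\sum_{n=0}^\infty 2^{-n}d_X(x_n,y_n)$. The shift $\sigma_T:X_T\to X_T$ is $\sigma_T(\{x_n\}_n)=\{x_{n+1}\}_n$. The entropy of the action is $h(T):=h(\sigma_T)$, the usual topological entropy of the continuous map $\sigma_T$, i.e. $h(T)=\lim_{\varepsilon\to0}\limsup_{n\to\infty}\frac1n\log s(n,\varepsilon)$, where $s(n,\varepsilon)$ is the largest cardinality of a set $F\subset X_T$ such that $\max_{0\le i\le n-1}d_{X_T}(\sigma_T^i\bar x,\sigma_T^i\bar y)>\varepsilon$ for all distinct $\bar x,\bar y\in F$. In the Riemannian case, $\|d_xT_i\|$ is the operator norm of the differential with respect to the Riemannian metric, and $d_X$ is the Riemannian distance. *)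

(* Defs.v *)
From mathcomp Require Export all_boot all_order all_algebra.
From mathcomp Require Export all_classical all_reals all_analysis.
Export Order.TTheory GRing.Theory Num.Theory.
Export numFieldNormedType.Exports.

Set Implicit Arguments.
Unset Strict Implicit.
Unset Printing Implicit Defensive.

Local Open Scope classical_set_scope.
Local Open Scope ring_scope.

Section actions.
Variables (k : nat) (X : topologicalType).

(* Z_+^k is the additive monoid {ffun 'I_k -> nat}. *)
Definition continuous_action (T : {ffun 'I_k -> nat} -> X -> X) : Prop :=
  [/\ T 0 = id,
      forall u v, T (u + v) = T u \o T v &
      forall u, continuous (T u)].

Definition generator (T : {ffun 'I_k -> nat} -> X -> X) (i : 'I_k) : X -> X :=
  T [ffun j => (j == i : nat)].

End actions.

Section metric_invariants.
Variable R : realType.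

Definition covering_number (X : metricType R) (e : R) : \bar R :=
  ereal_inf [set n%:R%:E | n in
    [set n | exists C : set X,
      (C #= `I_n)%card /\ [set: X] `<=` \bigcup_(x in C) ball x e]].

Definition ball_dimension (X : metricType R) : \bar R :=
  limf_esup (fun e : R => (lne (covering_number X e) / `|ln e|%:E)%E) 0^'+.

Definition lipschitz_with (X : metricType R) (L : R) (f : X -> X) : Prop :=
  forall x y, mdist (f x) (f y) <= L * mdist x y.

Section entropy.
(* S is a subset of Y, invariant under f, on which d is a distance. *)
Variables (Y : Type) (S : set Y) (d : Y -> Y -> R) (f : Y -> Y).

Definition bowen_dist (n : nat) (x y : Y) : R :=
  \big[Num.max/0]_(i < n) d (iter i f x) (iter i f y).

Definition separated_number (n : nat) (e : R) : \bar R :=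
  ereal_sup [set p%:R%:E | p in
    [set p | exists F : set Y, [/\ F `<=` S, (F #= `I_p)%card &
      forall x y, F x -> F y -> x <> y -> e < bowen_dist n x y]]].

Definition topological_entropy : \bar R :=
  lim ((fun e : R =>
    limn_esup (fun n => (n%:R^-1%:E * lne (separated_number n e))%E)) @ 0^'+).

End entropy.

Section friedland.
Variables (k : nat) (X : metricType R) (T : {ffun 'I_k -> nat} -> X -> X).

Definition orbit_space : set (nat -> X) :=
  [set x | forall n, exists i : 'I_k, generator T i (x n) = x n.+1].

Definition orbit_dist (x y : nat -> X) : R :=
  limn (series (fun n => 2 ^- n * mdist (x n) (y n))).

Definition shift_map (x : nat -> X) : nat -> X := fun n => x n.+1.

Definition friedland_entropy : \bar R :=
  topological_entropy orbit_space orbit_dist shift_map.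

End friedland.

End metric_invariants.

Section riemannian.
Variable R : realType.

Fixpoint class_C (n : nat) (V W : normedModType R) (U : set V) (f : V -> W) :
    Prop :=
  match n with
  | 0 => forall x, U x -> {for x, continuous f}
  | n'.+1 => (forall x, U x -> differentiable f x) /\
             (forall v, class_C n' U (fun x => 'd f x v))
  end.

Definition smooth_on (V W : normedModType R) (U : set V) (f : V -> W) : Prop :=
  forall n, class_C n U f.

Definition inner (m : nat) (g : 'M[R]_m) (u v : 'rV[R]_m) : R :=
  (u *m g *m v^T) 0 0.

(* A smooth manifold of dimension m with a smooth Riemannian metric.  chart i
   is meaningful on dom i only, and chart_inv i on chart i @` dom i only;
   gram i p is the Gram matrix at p of the metric read in the chart i. *)
Record riemannian_manifold (m : nat) (X : topologicalType) := {
  chart_index : Type ;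
  dom : chart_index -> set X ;
  chart : chart_index -> X -> 'rV[R]_m ;
  chart_inv : chart_index -> 'rV[R]_m -> X ;
  gram : chart_index -> 'rV[R]_m -> 'M[R]_m ;
  (* a chosen chart around each point *)
  chart_at : X -> chart_index ;
  chart_at_dom : forall x, dom (chart_at x) x ;
  dom_open : forall i, open (dom i) ;
  chart_open : forall i, open (chart i @` dom i) ;
  chartK : forall i x, dom i x -> chart_inv i (chart i x) = x ;
  chart_continuous : forall i x, dom i x -> {for x, continuous (chart i)} ;
  chart_inv_continuous : forall i p,
    (chart i @` dom i) p -> {for p, continuous (chart_inv i)} ;
  transition_smooth : forall i j,
    smooth_on (chart i @` (dom i `&` dom j)) (chart j \o chart_inv i) ;
  gram_smooth : forall i, smooth_on (chart i @` dom i) (gram i) ;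
  gram_sym : forall i p, (chart i @` dom i) p -> (gram i p)^T = gram i p ;
  gram_posdef : forall i p (v : 'rV[R]_m),
    (chart i @` dom i) p -> v != 0 -> 0 < inner (gram i p) v v ;
  gram_transition : forall i j p (u v : 'rV[R]_m),
    (chart i @` (dom i `&` dom j)) p ->
    inner (gram i p) u v =
    inner (gram j (chart j (chart_inv i p)))
      ('d (chart j \o chart_inv i) p u) ('d (chart j \o chart_inv i) p v) }.

Section manifold.
Variables (m : nat) (X : topologicalType) (M : riemannian_manifold m X).

(* The tangent space at x is 'rV[R]_m, through the chart chart_at x. *)
Definition tangent_norm (x : X) (v : 'rV[R]_m) : R :=
  Num.sqrt (inner (gram (chart_at M x) (chart (chart_at M x) x)) v v).

(* C^1 on a neighbourhood of [0, 1] *)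
Definition C1_curve (c : R -> X) : Prop :=
  forall t : R, 0 <= t <= 1 -> {for t, continuous c} /\
    forall i : chart_index M, dom i (c t) ->
      \forall s \near t, derivable (chart i \o c) s 1 /\
        {for s, continuous (derive1 (chart i \o c))}.

Definition curve_length (c : R -> X) : \bar R :=
  (\int[lebesgue_measure]_(t in `[0%R, 1%R])
    (tangent_norm (c t) (derive1 (chart (chart_at M (c t)) \o c) t))%:E)%E.

(* A piecewise C^1 path is given by the list of its C^1 pieces, each
   parametrized by [0, 1]. *)
Fixpoint piecewise_C1_path (s : seq (R -> X)) (x y : X) : Prop :=
  match s with
  | [::] => x = y
  | c :: s' => [/\ C1_curve c, c 0 = x & piecewise_C1_path s' (c 1) y]
  end.

(* +oo when x and y lie in different components *)
Definition riemannian_dist (x y : X) : \bar R :=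
  ereal_inf [set (\sum_(c <- s) curve_length c)%E | s in
    [set s | piecewise_C1_path s x y]].

Definition in_charts (f : X -> X) (x : X) : 'rV[R]_m -> 'rV[R]_m :=
  chart (chart_at M (f x)) \o f \o chart_inv (chart_at M x).

Definition differentiable_map (f : X -> X) : Prop :=
  forall x, {for x, continuous f} /\
    differentiable (in_charts f x) (chart (chart_at M x) x).

Definition tangent_map (f : X -> X) (x : X) : 'rV[R]_m -> 'rV[R]_m :=
  'd (in_charts f x) (chart (chart_at M x) x).

Definition tangent_map_norm (f : X -> X) (x : X) : R :=
  sup [set tangent_norm (f x) (tangent_map f x v) | v in
    [set v | tangent_norm x v <= 1]].

End manifold.

End riemannian.

(* Main.v *)
Require Import Defs.
From mathcomp Require Import ring lra.

(* Choose a word of generators followed by an orbit during the first n + M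
   steps; along this word the initial distance grows at most by the product
   of the constants L_+.  So, for each word w, a cover of X by balls of radius
   about e / L_+(w) bounds the number of (n, e)-separated orbits following w,
   and summing the powers L_+(w)^D' over all words, for D' > D(X), gives
   (L_+(T_1)^D' + ... + L_+(T_k)^D')^(n + M); then let D' tend to D(X).
   On a manifold, only upper bounds of the Riemannian distance are needed, and
   these come from straight segments in charts: they give D(X) <= m, and they
   show that d(f(c(0)), f(c(t))) - L * (length of c on [0, t]) has nonpositive
   upper right derivative along a C^1 curve c, so that f is Lipschitz although
   it is only differentiable. *)

Set Implicit Arguments.
Unset Strict Implicit.
Unset Printing Implicit Defensive.

Local Open Scope classical_set_scope.
Local Open Scope ring_scope.

(** * Coverings and separated orbits *)

Lemma limf_esup_le_fin (R : realType) (T : choiceType) (X : filteredType T)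
    (f : X -> \bar R) (F : set (set X)) (l : R) :
  (forall e, 0 < e -> F [set x | (f x <= (l + e)%:E)%E]) ->
  (limf_esup f F <= l%:E)%E.
Proof.
move=> fl; apply/lee_addgt0Pr => e /fl Fe.
apply: (le_trans (ereal_inf_lbound _)).
  by exists [set x | (f x <= (l + e)%:E)%E].
by apply: ge_ereal_sup => _ [x /= fx <-].
Qed.

Lemma limf_esup_lt (R : realType) (T : choiceType) (X : filteredType T)
    (f : X -> \bar R) (F : set (set X)) (l : \bar R) :
  (limf_esup f F < l)%E -> exists2 V, F V & forall x, V x -> (f x < l)%E.
Proof.
move=> /ereal_inf_lt[_ [V FV <-] Vl]; exists V => // x Vx.
by apply: le_lt_trans Vl; apply: ereal_sup_ubound; exists x.
Qed.

Lemma card_eq_II_inj (Y : Type) (F : set Y) (p : nat) :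
  (F #= `I_p)%card ->
  exists2 g : 'I_p -> Y, injective g & forall y, F y <-> exists i, y = g i.
Proof.
move=> /card_set_bijP[f [fF finj fsurj]].
have /choice[g gP] (i : 'I_p) : exists y, F y /\ f y = i.
  by have [y Fy <-] := fsurj i (ltn_ord i); exists y.
exists g => [i j gij|y].
  by apply: val_inj => /=; rewrite -(gP i).2 -(gP j).2 gij.
split => [Fy|[i ->]]; last exact: (gP i).1.
exists (Ordinal (fF _ Fy)); apply: finj; rewrite ?inE//; first exact: (gP _).1.
by rewrite (gP _).2.
Qed.

(** Pigeonhole with a relation in place of a coding function: an orbit may follow several words, so
    its code is not canonical. *)
Lemma card_eq_II_le_code (Y : Type) (J : finType) (F : set Y) (p : nat)
    (P : Y -> J -> Prop) : (F #= `I_p)%card ->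
  (forall x, F x -> exists j, P x j) ->
  (forall x y j, F x -> F y -> P x j -> P y j -> x = y) ->
  (p <= #|J|)%N.
Proof.
move=> /card_eq_II_inj[g ginj gF] FP Pinj.
have Fg i : F (g i) by apply/gF; exists i.
have /choice[c cP] i : exists j, P (g i) j by exact: FP.
have cinj : injective c.
  move=> i j cij; apply: ginj; apply: (Pinj _ _ (c i)) => //.
  by rewrite cij.
by have := leq_card c cinj; rewrite card_ord.
Qed.

Section covering.
Variables (R : realType) (X : metricType R).

(* A finite cover is encoded by a map to a finite type: its pieces are the
   fibres of the map. *)
Lemma covering_number_le_code (J : finType) (c : X -> J) (e : R) :
  (forall x y, c x = c y -> mdist x y < e) ->
  (covering_number X e <= #|J|%:R%:E)%E.
Proof.
(* [choose] returns the same point for all members of a fibre of [c], so [r] picks one centre per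
   fibre. *)
move=> cP; pose r x := choose [pred y | c y == c x] x.
have cr x : c (r x) = c x.
  by apply/eqP; apply: (@chooseP _ [pred y | c y == c x] x); exact: eqxx.
have rE x y : c x = c y -> r x = r y.
  move=> cxy; rewrite /r -cxy; by apply: choose_id => /=; rewrite ?cxy.
have rinj : {in range r &, injective c}.
  by move=> u v; rewrite !inE => -[a _ <-] [b _ <-]; rewrite !cr => /rE.
have rfin : finite_set (range r).
  apply: (card_le_finite (B := [set: J])) => //.
  by apply/card_subP; exists (c @` range r) => //; exact: inj_card_eq.
have /finite_setP[n rn] := rfin.
have nJ : (n <= #|J|)%N.
  apply: (card_eq_II_le_code (P := fun x j => c x = j) rn) => [x _|x y j rx ry xj yj].
    by exists (c x).
  by apply: rinj; rewrite ?inE// xj.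
apply: (@le_trans _ _ n%:R%:E); last by rewrite lee_fin ler_nat.
apply: ereal_inf_lbound; exists n => //; exists (range r); split => // x _.
exists (r x); first by exists x.
by rewrite ballEmdist; apply: cP; rewrite cr.
Qed.

(** Each point is coded by the index of a ball containing it; the factor 2 is the triangle
    inequality through the centre. *)
Lemma covering_number_lt_code (e : R) (b : R) :
  (covering_number X e < b%:E)%E ->
  exists2 n : nat, n%:R < b &
    exists c : X -> 'I_n, forall x y, c x = c y -> mdist x y < 2 * e.
Proof.
move=> /ereal_inf_lt[_ [n [C [Cn XC]] <-]]; rewrite lte_fin => nb.
exists n => //; have [g _ gC] := card_eq_II_inj Cn.
have /choice[c cP] x : exists i, mdist (g i) x < e.
  by have [z /gC[i ->]] := XC x I; rewrite ballEmdist => zx; exists i.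
exists c => x y cxy; apply: le_lt_trans (metric_triangle _ (g (c x)) _) _.
by rewrite mulr2n mulrDl mul1r ltrD// 1?metric_sym// cxy metric_sym.
Qed.

End covering.

Section orbits.
Variables (R : realType) (k : nat) (X : metricType R).
Variables (T : {ffun 'I_k -> nat} -> X -> X) (L : 'I_k -> R) (B : R).
Hypothesis L_ge1 : forall i, 1 <= L i.
Hypothesis TL : forall i, lipschitz_with (L i) (generator T i).
Hypothesis mdistB : forall x y : X, mdist x y <= B.

Lemma iter_shift_map (x : nat -> X) i j : iter i (@shift_map R X) x j = x (j + i)%N.
Proof. by elim: i j => [|i IH] j; rewrite ?addn0//= /shift_map IH addSnnS. Qed.

(** The first [M] coordinates contribute at most [2 * a], and the tail at most [B] times the
    geometric remainder [2 * 2 ^- M]. *)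
Lemma orbit_dist_le (x y : nat -> X) (a : R) (M : nat) : 0 <= a -> 0 <= B ->
  (forall n, (n < M)%N -> mdist (x n) (y n) <= a) ->
  orbit_dist x y <= 2 * a + 2 * B * 2 ^- M.
Proof.
move=> a0 B0 xya; set u := fun n => 2 ^- n * mdist (x n) (y n).
have p0 n : 0 < 2 ^- n :> R by rewrite invr_gt0 exprn_gt0.
have u0 n : 0 <= u n by rewrite mulr_ge0 ?mdist_ge0// ltW.
have uS n : 2 ^- n = 2 * 2 ^- n.+1 :> R.
  by rewrite exprS invfM mulrA divff ?mul1r// pnatr_eq0.
(* Kept sharp so that the induction closes; the second term vanishes as long as [n <= M]. *)
have su n : series u n <= 2 * a * (1 - 2 ^- n) + 2 * B * (2 ^- M - 2 ^- maxn M n).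
  elim: n => [|n IH].
    by rewrite /series/= big_geq// expr0 invr1 maxn0 !subrr !mulr0 addr0.
  rewrite /series/= big_nat_recr//=; apply: le_trans (lerD IH (lexx _)) _.
  rewrite /u; have [nM|Mn] := ltnP n M.
    have := ler_wpM2l (ltW (p0 n)) (xya n nM).
    rewrite (maxn_idPl nM) subrr mulr0 !addr0.
    have := uS n; nra.
  have := ler_wpM2l (ltW (p0 n)) (mdistB (x n) (y n)).
  rewrite (maxn_idPr (leqW Mn)).
  by have := uS n; have := p0 n.+1; nra.
have sub n : series u n <= 2 * a + 2 * B * 2 ^- M.
  apply: le_trans (su n) _; rewrite !mulrBr mulr1.
  have := p0 n; have := p0 (maxn M n); nra.
have uB : has_ubound (range (series u)).
  by exists (2 * a + 2 * B * 2 ^- M) => _ [n _ <-].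
have uc : cvgn (series u).
  by apply: nondecreasing_is_cvgn uB; exact/nondecreasing_series.
by apply: (limr_le uc); apply: nearW.
Qed.

(** Each letter costs its Lipschitz constant. As all constants are at least 1, the remaining letters
    only enlarge the product, which gives one bound for all times [m <= N]. *)
Lemma orbit_word_dist (w : nat -> 'I_k) (x y : nat -> X) (N m : nat) :
  (forall n, (n < N)%N -> generator T (w n) (x n) = x n.+1) ->
  (forall n, (n < N)%N -> generator T (w n) (y n) = y n.+1) ->
  (m <= N)%N ->
  mdist (x m) (y m) <= (\prod_(0 <= j < N) L (w j)) * mdist (x 0%N) (y 0%N).
Proof.
move=> wx wy mN; have L0 i : 0 <= L i by apply: le_trans (L_ge1 i).
have : mdist (x m) (y m) <= (\prod_(0 <= j < m) L (w j)) * mdist (x 0%N) (y 0%N).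
  elim: m mN => [|m IH] mN; first by rewrite big_geq// mul1r.
  rewrite -wx// -wy//; apply: le_trans (TL _ _ _) _.
  by rewrite big_nat_recr//= [X in _ <= X * _]mulrC -mulrA ler_wpM2l// IH// ltnW.
move/le_trans; apply; rewrite ler_wpM2r ?mdist_ge0//.
rewrite (big_cat_nat (leq0n m) mN)/= ler_peMr ?prodr_ge0//.
by elim/big_ind : _ => // u v u1 v1; rewrite mulr_ege1.
Qed.

(** The Bowen distance sees the times below [n], and [M] further coordinates control the orbit
    metric after each shift; hence words of length [n + M]. Separated orbits with a common word must
    start in different pieces of the cover chosen for that word. *)
Lemma separated_number_orbit_le (D e r0 : R) (M n : nat) :
  0 < e -> 0 <= B -> 2 * B * 2 ^- M <= e / 2 -> e / 8 < r0 ->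
  (forall d, 0 < d -> d < r0 -> (covering_number X d < (d^-1 `^ D)%:E)%E) ->
  (separated_number (orbit_space T) (@orbit_dist R X) (@shift_map R X) n e <=
   ((8 / e) `^ D * (\sum_(i < k) L i `^ D) ^+ (n + M))%:E)%E.
Proof.
move=> e0 B0 BM er0 covX; pose N := (n + M)%N.
have L0 i : 0 < L i by apply: lt_le_trans (L_ge1 i).
pose PL (w : {ffun 'I_N -> 'I_k}) := \prod_(j < N) L (w j).
have PL1 w : 1 <= PL w.
  by rewrite /PL; elim/big_ind : _ => // u v u1 v1; rewrite mulr_ege1.
have PL0 w : 0 < PL w by apply: lt_le_trans (PL1 w).
(* Points of one piece are less than [2 * d w] apart, so their orbits along [w] stay within [e / 4];
   then [orbit_dist_le] gives at most [2 * (e / 4) + e / 2 = e], against separation. *)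
pose d w := e / 8 / PL w.
have d0 w : 0 < d w by rewrite !divr_gt0.
have dr0 w : d w < r0.
  by apply: le_lt_trans er0; rewrite ler_pdivrMr// ler_peMr// divr_ge0// ltW.
have /choice[b bP] w : exists b : nat, b%:R < (d w)^-1 `^ D /\
    exists c : X -> 'I_b, forall x y, c x = c y -> mdist x y < 2 * d w.
  by have [b ? ?] := covering_number_lt_code (covX _ (d0 w) (dr0 w)); exists b.
pose c w := projT1 (cid (bP w).2).
have cP w x y : c w x = c w y -> mdist x y < 2 * d w.
  exact: projT2 (cid (bP w).2) x y.
apply: ge_ereal_sup => _ [p [F [FS Fp Fsep]] <-]; rewrite lee_fin.
pose P (x : nat -> X) (j : {w & 'I_(b w)}) := exists wx : nat -> 'I_k,
  [/\ forall m, generator T (wx m) (x m) = x m.+1, forall i : 'I_N, wx i = tag j i &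
      c (tag j) (x 0%N) = tagged j].
have pJ : (p <= #|{: {w & 'I_(b w)}}|)%N.
  apply: (card_eq_II_le_code (P := P) Fp) => [x /FS /choice[wx wxP]|x y j Fx Fy].
    pose w := [ffun i : 'I_N => wx i].
    exists (Tagged (fun w => 'I_(b w)) (c w (x 0%N))), wx.
    by split => // i; rewrite ffunE.
  case: j => w i [wx [/= xS wxw cx]] [wy [/= yS wyw cy]].
  apply: contrapT => /(Fsep _ _ Fx Fy); apply/negP; rewrite -leNgt.
  have wyx m : (m < N)%N -> wy m = wx m.
    by move=> mN; have := wxw (Ordinal mN); have := wyw (Ordinal mN) => /= -> ->.
  have xyN m : (m <= N)%N -> mdist (x m) (y m) <= e / 4.
    move=> mN; apply: le_trans (orbit_word_dist (w := wx) _ _ mN) _ => //.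
      by move=> j /wyx <-.
    have -> : \prod_(0 <= j < N) L (wx j) = PL w.
      by rewrite big_mkord; apply: eq_bigr => j _; rewrite wxw.
    have -> : e / 4 = PL w * (2 * d w) by rewrite /d; field; rewrite gt_eqF.
    by rewrite ler_wpM2l ?(ltW (PL0 w))// ltW// cP// cx cy.
  apply: bigmax_le => [|j _]; first exact: ltW.
  have e4 : 0 <= e / 4 by rewrite divr_ge0// ltW.
  apply: le_trans (orbit_dist_le (a := e / 4) (M := M) _ _ _) _ => //; last by lra.
  by move=> m mM; rewrite !iter_shift_map xyN// /N addnC leq_add// ltnW.
have powR_prod (w : {ffun 'I_N -> 'I_k}) : PL w `^ D = \prod_(j < N) L (w j) `^ D.
  suff [] : 0 <= PL w /\ PL w `^ D = \prod_(j < N) L (w j) `^ D by [].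
  rewrite /PL; elim/big_rec2 : _ => [|j u v _ [v0 vD]]; first by rewrite powR1.
  by rewrite mulr_ge0 ?powRM ?vD// ltW.
apply: (@le_trans _ _ #|{: {w & 'I_(b w)}}|%:R); first by rewrite ler_nat.
rewrite card_tagged sumnE big_map big_enum natr_sum (eq_bigl xpredT)//=.
apply: (@le_trans _ _
  (\sum_(w : {ffun 'I_N -> 'I_k}) (8 / e) `^ D * \prod_(j < N) L (w j) `^ D)).
  apply: ler_sum => w _; rewrite card_ord; apply: le_trans (ltW (bP w).1) _.
  have -> : (d w)^-1 = 8 / e * PL w by rewrite /d; field; rewrite !gt_eqF.
  by rewrite powRM ?powR_prod// ?divr_ge0// ltW.
(* Distributivity: summing the products of letter weights over all words gives the [N]-th power of
   the sum of the weights. *)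
rewrite -mulr_sumr -(bigA_distr_bigA (fun (j : 'I_N) i => L i `^ D))/=.
by rewrite prodr_const card_ord.
Qed.

End orbits.

(** * Limits defining entropy and ball dimension *)

Section entropy_bounds.
Variables (R : realType) (Y : Type) (S : set Y) (d : Y -> Y -> R) (f : Y -> Y).

Lemma separated_number_ge0 n e : (0 <= separated_number S d f n e)%E.
Proof.
apply: ereal_sup_ubound; exists 0%N => //; exists set0; split => //.
by rewrite II0.
Qed.

Lemma separated_number_anti n (e e' : R) : e <= e' ->
  (separated_number S d f n e' <= separated_number S d f n e)%E.
Proof.
move=> ee'; apply: ereal_sup_le => _ [p [F [FS Fp Fsep]] <-].
exists p => //; exists F; split => // x y Fx Fy xy.
exact: le_lt_trans ee' (Fsep _ _ Fx Fy xy).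
Qed.

(** [lim] is meaningful only for a convergent function. Here the upper limit in [n] is nonincreasing
    in [e], so it converges as [e] decreases to 0. *)
Lemma topological_entropy_le (l : \bar R) :
  (\forall e \near 0^'+, (limn_esup (fun n =>
     n%:R^-1%:E * lne (separated_number S d f n e)) <= l)%E) ->
  (topological_entropy S d f <= l)%E.
Proof.
move=> hl; apply: lime_le hl; apply: nonincreasing_at_right_is_cvge.
apply: nearW => x e e' _ _ ee'; rewrite /limn_esup/= !limf_esupE.
apply: le_ereal_inf_tmp => _ [V oV <-].
apply: (le_trans (ereal_inf_lbound _)); first by exists V.
apply: ge_ereal_sup => _ [n Vn <-].
apply: le_ereal_sup_tmp; exists ((n%:R^-1)%:E * lne (separated_number S d f n e))%E.
  by exists n.
apply: lee_wpmul2l; first by rewrite lee_fin invr_ge0.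
by rewrite lee_lne ?separated_number_anti// in_itv/= separated_number_ge0 leey.
Qed.

End entropy_bounds.

Lemma covering_number_ge0 (R : realType) (X : metricType R) (e : R) :
  (0 <= covering_number X e)%E.
Proof. by apply: le_ereal_inf_tmp => _ [n _ <-]; rewrite lee_fin. Qed.

(** Once [e < 1], the absolute value of [ln e] is [ln e^-1], and the bound on the quotient of
    logarithms exponentiates. *)
Lemma ball_dimension_lt_covering (R : realType) (X : metricType R) (D : R) :
  (ball_dimension X < D%:E)%E ->
  exists2 r, 0 < r &
    forall e, 0 < e -> e < r -> (covering_number X e < (e^-1 `^ D)%:E)%E.
Proof.
move=> /limf_esup_lt[V [r /= r0 rV] VD]; exists (Num.min r 1).
  by rewrite lt_min r0/=.
move=> e e0; rewrite lt_min => /andP[er e1].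
have {}/VD : V e by apply: rV => //=; rewrite sub0r normrN gtr0_norm.
have lne0 : ln e < 0 by rewrite ln_lt0// e0.
rewrite lt_neqAle; have ln0 : 0 < `|ln e| by rewrite normr_gt0 lt_eqF.
rewrite -lt_neqAle inver gt_eqF// lte_pdivrMr// -EFinM ltr0_norm//.
rewrite -lnV ?posrE// -ln_powR -lne_EFin ?powR_gt0 ?invr_gt0//.
rewrite lte_lne// in_itv/= leey ?covering_number_ge0// lee_fin.
by rewrite powR_ge0.
Qed.

Lemma mdist_continuous (R : realType) (X : metricType R) (x0 : X) :
  continuous (mdist x0 : X -> R).
Proof.
move=> x; apply/cvgrPdist_lt => e e0.
have : \forall y \near x, mdist x y < e.
  by apply/nbhs_ballP; exists e => //= y; rewrite ballEmdist.
apply: filterS => y xy; apply: le_lt_trans xy; rewrite ler_norml.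
have := metric_triangle x0 x y; have := metric_triangle x0 y x.
by rewrite (metric_sym y x); lra.
Qed.

Lemma compact_mdist_bounded (R : realType) (X : metricType R) :
  compact [set: X] -> exists2 B : R, 0 <= B & forall x y : X, mdist x y <= B.
Proof.
move=> cX; have [[x0]|nX] := pselect (inhabited X); last first.
  by exists 0 => // x; exfalso; apply: nX.
have : compact (mdist x0 @` [set: X]).
  apply: continuous_compact => //; apply: continuous_subspaceT.
  exact: mdist_continuous.
move/compact_bounded => [M [_ /(_ (M + 1))]]; rewrite ltrDl ltr01 => /(_ isT) XM.
pose B := M + 1; have xB x : mdist x0 x <= B.
  by apply: le_trans (ler_norm _) _; apply: XM; exists x.
exists (B + B).
  by rewrite -mulr2n mulrn_wge0// (le_trans _ (xB x0))// mdist_ge0.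
move=> x y; apply: le_trans (metric_triangle _ x0 _) _.
by rewrite lerD// metric_sym.
Qed.

(** * Entropy bound for Lipschitz generators *)

Section lipschitz_bound.
Variables (R : realType) (k : nat) (X : metricType R).
Variables (T : {ffun 'I_k -> nat} -> X -> X) (L : 'I_k -> R).
Hypothesis k_gt0 : (0 < k)%N.
Hypothesis cptX : compact [set: X].
Hypothesis L_ge1 : forall i, 1 <= L i.
Hypothesis TL : forall i, lipschitz_with (L i) (generator T i).

Lemma sum_powR_gt0 (D : R) : 0 < \sum_(i < k) L i `^ D.
Proof.
rewrite (bigD1 (Ordinal k_gt0))//= ltr_pwDl ?sumr_ge0// => [|i _].
  by rewrite powR_gt0// (lt_le_trans ltr01).
exact: powR_ge0.
Qed.

(** At a fixed scale [e], the number of separated orbits is at most a constant times the [n]-th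
    power of the sum; the constant disappears after taking logarithms and dividing by [n]. *)
Lemma friedland_entropy_le_gt (D : R) : (ball_dimension X < D%:E)%E ->
  (friedland_entropy T <= (ln (\sum_(i < k) L i `^ D))%:E)%E.
Proof.
move=> /ball_dimension_lt_covering[r r0 covX].
have [B B0 XB] := compact_mdist_bounded cptX.
have S0 := sum_powR_gt0 D; set S := \sum_(i < k) _ in S0 *.
apply: topological_entropy_le; near=> e.
have e0 : 0 < e by near: e; exact: nbhs_right_gt.
have er : e / 8 < r.
  by rewrite ltr_pdivrMr//; near: e; apply: nbhs_right_lt; rewrite mulr_gt0.
(* [M] makes the tail of the orbit metric small; [B + 1] in place of [B] avoids a division by 0. *)
have [M BM] : exists M : nat, 2 * B * 2 ^- M <= e / 2.
  have d0 : 0 < e / (4 * (B + 1)) by rewrite divr_gt0// mulr_gt0// ltr_wpDl.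
  have [M _ /(_ M (leqnn M))] := near_infty_natSinv_expn_lt (PosNum d0).
  rewrite /= div1r => MB; exists M.
  have B10 : 0 < B + 1 by rewrite ltr_wpDl.
  have : 2 ^- M * (4 * (B + 1)) <= e by rewrite -ler_pdivlMr ?mulr_gt0// ltW.
  have : 0 < 2 ^- M :> R by rewrite invr_gt0 exprn_gt0.
  by nra.
(* The part of the logarithm that does not grow with [n]; it is at most [n%:R * g] for large [n]. *)
pose K := D * ln (8 / e) + M%:R * ln S.
apply: limf_esup_le_fin => g g0; near=> n.
have n0 : (0 < n)%N by near: n; exact: nbhs_infty_gt.
have nR : 0 < n%:R :> R by rewrite ltr0n.
rewrite /= lee_pdivrMl//.
have e8 : 0 < 8 / e by rewrite divr_gt0.
have := separated_number_orbit_le L_ge1 TL XB n e0 B0 BM er covX.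
rewrite -lee_lne; last 2 first.
- by rewrite in_itv/= separated_number_ge0 leey.
- by rewrite in_itv/= leey lee_fin mulr_ge0 ?powR_ge0 ?exprn_ge0 ?(ltW S0).
move=> sep_le; apply: (le_trans sep_le).
rewrite lne_EFin ?mulr_gt0 ?powR_gt0 ?exprn_gt0// -EFinM lee_fin.
rewrite lnM ?posrE ?powR_gt0 ?exprn_gt0// ln_powR lnXn// -[ln S *+ _]mulr_natl natrD.
have : K <= n%:R * g.
  by rewrite -ler_pdivrMr//; near: n; exact: nbhs_infty_ger.
by rewrite /K; lra.
Unshelve. all: by end_near. Qed.

(** The previous bound is applied with exponent [D + h]. If [A] bounds all the constants, the extra
    exponent [h] adds at most [h * ln A] to the logarithm of the sum. *)
Lemma friedland_entropy_le : (ball_dimension X < +oo)%E ->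
  (friedland_entropy T <= (ln (\sum_(i < k) L i `^ fine (ball_dimension X)))%:E)%E.
Proof.
move=> Dfin; set D := fine (ball_dimension X).
(* For dimension [-oo], [fine] gives 0 and the implication still holds. *)
have gtD D' : D < D' -> (ball_dimension X < D'%:E)%E.
  by rewrite /D; case: (ball_dimension X) Dfin => //= _ _; rewrite ltNyr.
have [A A1 LA] : exists2 A : R, 1 <= A & forall i, L i <= A.
  exists (\sum_(i < k) L i) => [|i].
    rewrite (bigD1 (Ordinal k_gt0))//= ler_wpDr// sumr_ge0// => i _.
    exact: le_trans ler01 (L_ge1 i).
  rewrite (bigD1 i)//= lerDl sumr_ge0// => j _.
  exact: le_trans ler01 (L_ge1 j).
have A0 : 0 < A by apply: lt_le_trans A1.
(* The denominator is [ln A + 1] because [ln A] may be 0; still [h * ln A <= g]. *)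
apply/lee_addgt0Pr => g g0; pose h := g / (ln A + 1).
have lnA : 0 <= ln A by rewrite ln_ge0.
have h0 : 0 < h by rewrite divr_gt0// ltr_wpDl.
apply: (le_trans (friedland_entropy_le_gt (gtD (D + h) _))); first by rewrite ltrDl.
rewrite -EFinD lee_fin.
have S0 := sum_powR_gt0.
apply: (@le_trans _ _ (ln (A `^ h * \sum_(i < k) L i `^ D))).
  rewrite ler_ln ?posrE ?mulr_gt0 ?powR_gt0// mulr_sumr; apply: ler_sum => i _.
  have Li0 : 0 < L i by apply: lt_le_trans (L_ge1 i).
  rewrite powRD ?(gt_eqF Li0) ?implybT// mulrC ler_wpM2r ?powR_ge0//.
  by apply: ge0_ler_powR; rewrite ?nnegrE ?LA ?(ltW Li0) ?(ltW A0) ?(ltW h0).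
rewrite lnM ?posrE ?powR_gt0// ln_powR addrC lerD2l.
rewrite /h mulrAC ler_pdivrMr ?ltr_wpDl//; nra.
Qed.

End lipschitz_bound.

(** * Real analysis *)

Section real_analysis.
Variable R : realType.
Implicit Types (h v : R -> R) (V : normedModType R).

Lemma derivable_near_le V (f : R -> V) (t e : R) : derivable f t 1 -> 0 < e ->
  \forall s \near t, `|f s - f t - (s - t) *: derive1 f t| <= e * `|s - t|.
Proof.
move=> /derivable1_diffP df e0; have /diff_locallyP[_ /eqaddoP/(_ e e0)] := df.
move=> fe; apply/nbhs0P; apply: filterS fe => z /=.
rewrite !fctE/= [t + z]addrC addrK opprD addrA derive1E deriveE//.
have -> // : 'd f t z = z *: 'd f t 1.
by rewrite -linearZ/= [z *: _]mulr1.
Qed.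

Lemma difference_quotient_cvg V (h : R -> V) (t : R) (l : V) :
  is_derive t (1 : R) h l -> (s - t)^-1 *: (h s - h t) @[s --> t^'+] --> l.
Proof.
move=> [dh hl]; apply/cvgrPdist_le => e e0; near=> s.
have st0 : 0 < s - t by rewrite subr_gt0; near: s; exact: nbhs_right_gt.
have -> : l - (s - t)^-1 *: (h s - h t) = (s - t)^-1 *: ((s - t) *: l - (h s - h t)).
  by rewrite [RHS]scalerBr scalerA mulVf ?scale1r// gt_eqF.
rewrite normrZ gtr0_norm ?invr_gt0// ler_pdivrMl// distrC mulrC -{2}(gtr0_norm st0).
rewrite -hl -derive1E; near: s; rewrite near_withinE.
by apply: filterS (derivable_near_le dh e0) => s.
Unshelve. all: by end_near. Qed.

(** A Dini derivative argument: with a slope [e] allowed, the supremum of the times [t] with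
    [h t <= h 0 + e * t] is attained and must be 1. *)
Lemma increment_le0_le h : (forall t, 0 <= t <= 1 -> {for t, continuous h}) ->
  (forall t e, 0 <= t < 1 -> 0 < e ->
     \forall s \near t^'+, h s - h t <= e * (s - t)) ->
  h 1 <= h 0.
Proof.
move=> ch dh; apply/ler_addgt0Pr => e e0.
pose E := [set t | 0 <= t <= 1 /\ h t <= h 0 + e * t].
have E0 : E 0 by split; rewrite ?lexx ?ler01// mulr0 addr0.
have supE : has_sup E by split; [exists 0|exists 1 => t [/andP[]]].
pose c := sup E; have c0 : 0 <= c by apply: sup_ubound => //; exact: supE.2.
have c1 : c <= 1 by apply: sup_le_ub => [|t [/andP[]]]//; exists 0.
(* Otherwise [h t - e * t > h 0] on a neighbourhood of [c], yet points of [E] come arbitrarily close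
   to [c]. *)
have cE : h c <= h 0 + e * c.
  rewrite leNgt; apply/negP => hc.
  have c01 : 0 <= c <= 1 by rewrite c0.
  have hec : {for c, continuous (fun t => h t - e * t)}.
    by apply: continuousB; [exact: ch|apply: continuousM; [exact: cst_continuous|]].
  have hc' : h 0 < h c - e * c by rewrite ltrBrDr.
  have hn : \forall t \near c, h 0 < h t - e * t by exact: cvgr_gt hec _ hc'.
  move: hn => /nbhs_ballP[r /= r0 rh].
  have [t [t01 Et] ct] := sup_adherent r0 supE.
  have tc : t <= c by apply: sup_ubound => //; exact: supE.2.
  have := rh t; rewrite /ball/= ger0_norm ?subr_ge0// ltrBlDr -ltrBlDl => /(_ _).
  have -> : c - r < t by [].
  by move=> /(_ isT); rewrite ltNge => /negP; apply; rewrite lerBlDr.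
have [c1'|c1'] := ltP c 1; last first.
  have <- : c = 1 by apply/eqP; rewrite eq_le c1.
  by rewrite (le_trans cE)// lerD2l ger_pMr.
(* If [c < 1], the hypothesis at [c] puts some [s > c] into [E]. *)
have : \forall s \near c^'+, [/\ c < s, s < 1 & h s - h c <= e * (s - c)].
  near=> s; split; near: s.
  - exact: nbhs_right_gt.
  - exact: nbhs_right_lt.
  - by apply: dh; rewrite ?c0.
case/filter_ex => s [cs s1 hs]; have csW := ltW cs.
exfalso; move: cs; apply/negP; rewrite -leNgt.
apply: sup_ubound; first exact: supE.2.
split; first by rewrite (le_trans c0 csW) ltW.
lra.
Unshelve. all: by end_near. Qed.

(** [v] is controlled only on the unit interval. Clamping its argument gives a function continuous
    everywhere, so that the fundamental theorem of calculus yields two-sided derivatives even at 0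
    and 1. *)
Lemma continuous_integral_antiderivative v :
  (forall t, 0 <= t <= 1 -> {for t, continuous v}) ->
  exists V : R -> R, (forall t : R, 0 <= t <= 1 -> is_derive t 1 V (v t)) /\
    (\int[lebesgue_measure]_(t in `[0%R, 1%R]) (v t)%:E = (V 1 - V 0)%:E)%E.
Proof.
move=> cv; pose cl t : R := Num.max 0 (Num.min 1 t).
have cl01 t : 0 <= cl t <= 1 by rewrite /cl le_max lexx/= ge_max ler01 ge_min lexx.
have clE t : 0 <= t <= 1 -> cl t = t.
  by move=> /andP[t0 t1]; rewrite /cl (min_idPr t1) (max_idPr t0).
have ccl : continuous cl.
  move=> t; apply: continuous_max; first exact: cst_continuous.
  by apply: continuous_min => //; exact: cst_continuous.
pose w := v \o cl.
have cw : continuous w by move=> t; apply: continuous_comp; [exact: ccl|exact: cv].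
(* The base point [-1], with [2] as right end, makes 0 and 1 interior points. *)
pose V (x : R) : R := (\int[lebesgue_measure]_(t in `[(-1)%R, x]) w t)%R.
have iw : lebesgue_measure.-integrable `[(-1)%R, 2%R] (EFin \o w).
  apply: continuous_compact_integrable; first exact: segment_compact.
  exact: continuous_subspaceT.
have VP (t : R) : 0 <= t <= 1 -> derivable V t 1 /\ derive1 V t = w t.
  move=> /andP[t0 t1].
  apply: (continuous_FTC1_closed (u := 2)) iw _ _ => //; last exact: cw.
    by lra.
  by lra.
have cV t : 0 <= t <= 1 -> {for t, continuous V}.
  by move=> /VP[/derivable1_diffP/differentiable_continuous].
exists V; split=> [t t01|].
  have [dV Vw] := VP t t01.
  apply: DeriveDef => //; rewrite -derive1E Vw /w/= clE//.
rewrite EFinB -(@continuous_FTC2 _ w V 0 1)//.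
- apply: eq_integral => t; rewrite inE/= in_itv/= => t01.
  by rewrite /w/= clE.
- exact: continuous_subspaceT.
- split=> [t|/=|/=].
  + rewrite in_itv/= => /andP[t0 t1]; apply: (VP t _).1; by rewrite !ltW.
  + by apply: cvg_at_right_filter; apply: cV; rewrite lexx ler01.
  + by apply: cvg_at_left_filter; apply: cV; rewrite lexx ler01.
- move=> t; rewrite in_itv/= => /andP[t0 t1]; apply: (VP t _).2; by rewrite !ltW.
Qed.

End real_analysis.

(** * Bilinear forms given by Gram matrices *)

Section inner_product.
Variables (R : realType) (m : nat).
Implicit Types (g : 'M[R]_m) (u v : 'rV[R]_m).

Lemma innerE g u v :
  inner g u v = \sum_j (\sum_i u 0 i * g i j) * v 0 j.
Proof.
by rewrite /inner !mxE; apply: eq_bigr => j _; rewrite !mxE.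
Qed.

Lemma innerZ g (a : R) v : inner g (a *: v) (a *: v) = a ^+ 2 * inner g v v.
Proof.
by rewrite /inner linearZ/= -!scalemxAl -scalemxAr !mxE mulrA expr2.
Qed.

Lemma innerB g1 g2 v : inner (g1 - g2) v v = inner g1 v v - inner g2 v v.
Proof. by rewrite /inner mulmxBr mulmxBl !mxE. Qed.

Lemma inner0 g : inner g 0 0 = 0.
Proof. by rewrite /inner !mul0mx mxE. Qed.

Lemma entry_le_norm p q (A : 'M[R]_(p, q)) i j : `|A i j| <= `|A|.
Proof.
rewrite [leRHS]mx_normrE.
exact: (le_bigmax _ (fun ij : 'I_p * 'I_q => `|A ij.1 ij.2|) (i, j)).
Qed.

(** The norm of a matrix is its largest absolute entry, and the form is a sum over [m ^ 2] pairs of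
    indices. *)
Lemma inner_le_norm g v : `|inner g v v| <= m%:R ^+ 2 * `|g| * `|v| ^+ 2.
Proof.
rewrite innerE; apply: le_trans (ler_norm_sum _ _ _) _.
have -> : m%:R ^+ 2 * `|g| * `|v| ^+ 2 =
    \sum_(j < m) (\sum_(i < m) `|v| * `|g|) * `|v|.
  have sumE (a : R) : \sum_(i < m) a = m%:R * a.
    by rewrite sumr_const card_ord mulr_natl.
  by rewrite !sumE; ring.
apply: ler_sum => j _; rewrite normrM ler_pM ?entry_le_norm//.
apply: le_trans (ler_norm_sum _ _ _) _; apply: ler_sum => i _.
by rewrite normrM ler_pM ?entry_le_norm.
Qed.

Lemma inner_cvg (T : Type) (F : set_system T) {FF : Filter F}
    (G : T -> 'M[R]_m) (U : T -> 'rV[R]_m) g u :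
  G @ F --> g -> U @ F --> u -> inner (G x) (U x) (U x) @[x --> F] --> inner g u u.
Proof.
move=> Gg Uu.
have entry p q (A : T -> 'M[R]_(p, q)) (B : 'M[R]_(p, q)) i j :
    A @ F --> B -> A x i j @[x --> F] --> B i j.
  move=> AB; apply: (@cvg_comp _ _ _ A (fun N : 'M[R]_(p, q) => N i j) _ _ _ AB).
    exact: coord_continuous.
under eq_fun do rewrite innerE; rewrite innerE.
apply: cvg_big => [|j _]; first exact: add_continuous.
apply: cvgM; last exact: entry.
apply: cvg_big => [|i _]; first exact: add_continuous.
by apply: cvgM; exact: entry.
Qed.

(** On the compact unit sphere the form has a positive minimum [a]; by homogeneity the inverse of
    the square root of [a] serves as [C]. *)
Lemma inner_coercive g : (forall v, v != 0 -> 0 < inner g v v) ->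
  exists2 C : R, 0 <= C & forall v, `|v| <= C * Num.sqrt (inner g v v).
Proof.
move=> g0; pose S := [set v : 'rV[R]_m | `|v| = 1].
have nS v : v != 0 -> S (`|v|^-1 *: v).
  by move=> v0; rewrite /S/= normrZ normfV normr_id mulVf// normr_eq0.
(* If the sphere is empty, as for [m = 0], then 0 is the only vector. *)
have [S0|S0] := pselect (S !=set0); last first.
  exists 0 => // v; have [->|/nS Sv] := eqVneq v 0; first by rewrite normr0 mul0r.
  by exfalso; apply: S0; exists (`|v|^-1 *: v).
have cS : compact S.
  apply: bounded_closed_compact.
    by exists 1; split => // x x1 v /= ->; exact: ltW.
  have -> : S = (fun v : 'rV[R]_m => `|v|) @^-1` [set 1] by [].
  apply: closed_comp => [v _|]; last exact: closed_eq.
  exact: (@norm_continuous R 'rV[R]_m v).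
have cI : {within S, continuous (fun v => inner g v v)}.
  apply: continuous_subspaceT => v.
  by have := @inner_cvg _ (nbhs v) _ (fun=> g) id g v (cvg_cst g) cvg_id; apply.
have [c] := compact_EVT_min S0 cS cI; rewrite inE => Sc cmin.
have a0 : 0 < inner g c c.
  by apply: g0; rewrite -normr_gt0 [X in _ < X]Sc.
set a := inner g c c in a0 cmin.
have sa0 : 0 < Num.sqrt a by rewrite sqrtr_gt0.
exists (Num.sqrt a)^-1 => [|v]; first by rewrite invr_ge0 ltW.
have [->|v0] := eqVneq v 0.
  by rewrite normr0 mulr_ge0 ?sqrtr_ge0// invr_ge0 ltW.
have nv0 : 0 < `|v| by rewrite normr_gt0.
have : a <= inner g (`|v|^-1 *: v) (`|v|^-1 *: v).
  by apply: cmin; rewrite inE; exact: nS.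
rewrite innerZ exprVn mulrC ler_pdivlMr ?exprn_gt0// => av.
rewrite mulrC ler_pdivlMr// -[`|v|](ger0_norm (normr_ge0 _)) -sqrtr_sqr.
rewrite -sqrtrM ?sqr_ge0//.
by rewrite ler_sqrt ?(ltW (g0 _ v0))// mulrC.
Qed.

End inner_product.

(** * Riemannian distance in charts *)

Section charts.
Variables (R : realType) (m : nat) (X : topologicalType).
Variable M : riemannian_manifold R m X.
Implicit Types (i j : chart_index M) (p q v : 'rV[R]_m) (x : X) (c : R -> X).

(** The metric read in an arbitrary chart; [tangent_norm M x] is convertible to the case of the
    chart [chart_at M x]. *)
Definition chart_norm i p v : R := Num.sqrt (inner (gram i p) v v).

(** The integrand of [curve_length]. Its chart changes with [t], so even continuity needs an
    argument. *)
Definition speed c (t : R) : R :=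
  tangent_norm M (c t) (derive1 (chart (chart_at M (c t)) \o c) t).

Lemma chart_normZ i p (a : R) v : chart_norm i p (a *: v) = `|a| * chart_norm i p v.
Proof. by rewrite /chart_norm innerZ sqrtrM ?sqr_ge0// sqrtr_sqr. Qed.

Lemma chart_invK i p : (chart i @` dom i) p ->
  dom i (chart_inv i p) /\ chart i (chart_inv i p) = p.
Proof. by move=> [x ix <-]; rewrite chartK. Qed.

Lemma overlap_open i j : open (chart i @` (dom i `&` dom j)).
Proof.
rewrite openE => p [x [ix jx] <-]; rewrite /interior/=.
have ip : (chart i @` dom i) (chart i x) by exists x.
have : \forall q \near chart i x, (chart i @` dom i) q.
  by apply: open_nbhs_nbhs; split => //; exact: chart_open.
have : \forall q \near chart i x, dom j (chart_inv i q).
  apply: (chart_inv_continuous ip); rewrite chartK//.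
  by apply: open_nbhs_nbhs; split => //; exact: dom_open.
apply: filterS2 => q jq [y iy yq]; exists y => //; split => //.
by move: jq; rewrite -yq chartK.
Qed.

Lemma gram_cvg i p : (chart i @` dom i) p -> gram i q @[q --> p] --> gram i p.
Proof. by move=> ip; exact: (gram_smooth i 0%N). Qed.

Lemma transition_differentiable i j p : (chart i @` (dom i `&` dom j)) p ->
  differentiable (chart j \o chart_inv i) p.
Proof. by move=> ijp; have [/(_ p ijp)] := transition_smooth i j 1%N. Qed.

Lemma near_dom c t i : {for t, continuous c} -> dom i (c t) ->
  \forall s \near t, dom i (c s).
Proof.
by move=> cc it; apply: cc; apply: open_nbhs_nbhs; split => //; exact: dom_open.
Qed.

(** The chain rule carries the velocity through the transition map, and [gram_transition] says that
    this preserves the norm. *)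
Lemma speedE c t i : {for t, continuous c} -> dom i (c t) ->
  derivable (chart i \o c) t 1 ->
  speed c t = chart_norm i (chart i (c t)) (derive1 (chart i \o c) t).
Proof.
move=> cc it dc; rewrite /speed/tangent_norm; set j := chart_at M (c t).
have jt : dom j (c t) by exact: chart_at_dom.
have ijt : (chart i @` (dom i `&` dom j)) (chart i (c t)) by exists (c t).
have -> : derive1 (chart j \o c) t =
    'd (chart j \o chart_inv i) (chart i (c t)) (derive1 (chart i \o c) t).
  rewrite !derive1E.
  have cij : \forall s \near t,
      ((chart j \o chart_inv i) \o (chart i \o c)) s = (chart j \o c) s.
    by apply: filterS (near_dom cc it) => s /= ds; rewrite chartK.
  rewrite -(near_eq_derive _ cij).
  have dc' : differentiable (chart i \o c) t by exact/derivable1_diffP.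
  have dij := transition_differentiable ijt.
  rewrite deriveE; last exact: differentiable_comp.
  by rewrite diff_comp//= deriveE.
by rewrite /chart_norm (gram_transition _ _ ijt) chartK.
Qed.

Lemma chart_norm_cvg (T : Type) (F : set_system T) {FF : Filter F} i
    (P U : T -> 'rV[R]_m) p u : (chart i @` dom i) p ->
  P @ F --> p -> U @ F --> u ->
  chart_norm i (P s) (U s) @[s --> F] --> chart_norm i p u.
Proof.
move=> ip Pp Uu; have gP := @cvg_comp _ _ _ P (gram i) _ _ _ Pp (gram_cvg ip).
have := @inner_cvg _ _ T F FF (gram i \o P) U (gram i p) u gP Uu.
by move/cvg_comp; apply; exact: sqrt_continuous.
Qed.

(** [C1_curve] asserts continuity of [c] only at times of the unit interval. At nearby times, also
    outside it, continuity is recovered by composing [chart i \o c] with [chart_inv i]. *)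
Lemma C1_curve_near c t i : C1_curve M c -> 0 <= t <= 1 -> dom i (c t) ->
  \forall s \near t,
    [/\ {for s, continuous c}, dom i (c s) & derivable (chart i \o c) s 1].
Proof.
move=> c1 t01 it; have [cc /(_ i it) dc] := c1 t t01.
have := near_join (near_dom cc it); apply: filterS2 dc => s [dcs _] is_.
have dis := nbhs_singleton is_; split => //.
have cE : {near s, chart_inv i \o (chart i \o c) =1 c}.
  by apply: filterS is_ => r /= ir; rewrite chartK.
have : {for s, continuous (chart_inv i \o (chart i \o c))}.
  apply: continuous_comp; first exact/differentiable_continuous/derivable1_diffP.
  by apply: chart_inv_continuous; exists (c s).
rewrite /continuous_at/prop_for/= chartK// => h.
by apply: cvg_trans h; apply: near_eq_cvg; exact: filterS cE.
Qed.

(** Near [t] the speed agrees with its expression in the single chart chosen at [c t]. *)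
Lemma speed_continuous c t : C1_curve M c -> 0 <= t <= 1 ->
  {for t, continuous (speed c)}.
Proof.
move=> c1 t01; set i := chart_at M (c t).
have it : dom i (c t) by exact: chart_at_dom.
have near_i := C1_curve_near c1 t01 it.
have [cc _ dct] := nbhs_singleton near_i.
have [_ /(_ i it) /nbhs_singleton[_ dcc]] := c1 t t01.
have sE : \forall s \near t,
    chart_norm i (chart i (c s)) (derive1 (chart i \o c) s) = speed c s.
  by apply: filterS near_i => s [ccs ds dcs]; rewrite (speedE ccs ds dcs).
rewrite /continuous_at/prop_for -(nbhs_singleton sE).
apply: cvg_trans (near_eq_cvg sE) _.
have /derivable1_diffP/differentiable_continuous gc := dct.
have ip : (chart i @` dom i) (chart i (c t)) by exists (c t).
exact: (@chart_norm_cvg _ (nbhs t) _ i (chart i \o c)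
  (derive1 (chart i \o c)) _ _ ip gc dcc).
Qed.

Lemma curve_lengthE c : C1_curve M c -> exists V : R -> R,
  (forall t : R, 0 <= t <= 1 -> is_derive t 1 V (speed c t)) /\
  curve_length M c = (V 1 - V 0)%:E.
Proof.
by move=> c1; apply: continuous_integral_antiderivative => t; exact: speed_continuous.
Qed.

Lemma curve_length_ge0 c : (0 <= curve_length M c)%E.
Proof. by apply: integral_ge0 => t _; rewrite lee_fin sqrtr_ge0. Qed.

Lemma curve_length_le c (K : R) : C1_curve M c ->
  (forall t, 0 <= t <= 1 -> speed c t <= K) -> (curve_length M c <= K%:E)%E.
Proof.
move=> c1 sK; have [V [dV ->]] := curve_lengthE c1; rewrite lee_fin.
have cV : {within `[0, 1], continuous V}.
  apply: continuous_in_subspaceT => t; rewrite inE/= in_itv/= => /dV dVt.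
  exact/differentiable_continuous/derivable1_diffP.
have [|t] := MVT (@ltr01 R) _ cV (df := speed c).
  by move=> t; rewrite in_itv/= => /andP[t0 t1]; apply: dV; rewrite !ltW.
rewrite in_itv/= => /andP[t0 t1] ->; rewrite subr0 mulr1.
by apply: sK; rewrite !ltW.
Qed.

End charts.

(** * Straight segments in charts *)

Section segments.
Variables (R : realType) (m : nat) (X : topologicalType).
Variable M : riemannian_manifold R m X.
Implicit Types (i j : chart_index M) (p q v : 'rV[R]_m).

Definition chart_segment i p q (t : R) : X := chart_inv i (p + t *: (q - p)).

Lemma line_is_derive p v (t : R) : is_derive t (1:R) (fun s : R => p + s *: v) v.
Proof.
have dv : is_derive t (1:R) (fun s : R => s *: v) v.
  apply: DeriveDef; last by rewrite deriveE// diff_val/= scale1r.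
  exact/derivable1_diffP.
by rewrite -[X in is_derive _ _ _ X]add0r; exact: is_deriveD.
Qed.

Lemma line_continuous p v : continuous (fun s : R => p + s *: v).
Proof.
move=> t; have [dt _] := line_is_derive p v t.
exact/differentiable_continuous/derivable1_diffP.
Qed.

(** In a chart [j] the segment is the transition map after an affine path, so its velocity is the
    differential of the transition map applied to [q - p], which varies continuously. *)
Lemma chart_segment_C1 i p q :
  (forall t : R, 0 <= t <= 1 -> (chart i @` dom i) (p + t *: (q - p))) ->
  C1_curve M (chart_segment i p q).
Proof.
move=> pqi t /pqi it; split.
  apply: continuous_comp; first exact: line_continuous.
  exact: chart_inv_continuous.
move=> j jt; set z := fun s : R => p + s *: (q - p).
have ijt : (chart i @` (dom i `&` dom j)) (z t).
  have [? zt] := chart_invK it; exists (chart_inv i (z t)) => //.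
have ij : \forall s \near t, (chart i @` (dom i `&` dom j)) (z s).
  apply: (line_continuous (p := p) (v := q - p)).
  by apply: open_nbhs_nbhs; split => //; exact: overlap_open.
have dij : \forall s \near t, is_derive s (1:R) (chart j \o chart_segment i p q)
    ('d (chart j \o chart_inv i) (z s) (q - p)).
  apply: filterS ij => s ijs; have [dz zv] := line_is_derive p (q - p) s.
  have dphi := transition_differentiable ijs.
  have dz' : differentiable z s by exact/derivable1_diffP.
  have dc : differentiable ((chart j \o chart_inv i) \o z) s.
    exact: differentiable_comp.
  apply: DeriveDef; first exact/derivable1_diffP.
  by rewrite [LHS](deriveE _ dc) diff_comp//= -(deriveE _ dz') zv.
apply: filterS2 (near_join dij) ij => s dijs ijs.
have [d1 _] := nbhs_singleton dijs; split; first exact: d1.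
have dE : \forall r \near s, 'd (chart j \o chart_inv i) (z r) (q - p) =
    derive1 (chart j \o chart_segment i p q) r.
  by apply: filterS dijs => r [_ <-]; rewrite derive1E.
rewrite /continuous_at/prop_for -(nbhs_singleton dE).
apply: cvg_trans (near_eq_cvg dE) _.
have [_ /(_ (q - p)) c0] := transition_smooth i j 1%N.
have zc : {for s, continuous z} by exact: line_continuous.
exact: (@continuous_comp _ _ _ z
  (fun x => 'd (chart j \o chart_inv i) x (q - p)) s zc (c0 _ ijs)).
Qed.

Lemma chart_segment_speed i p q (t : R) :
  (forall t : R, 0 <= t <= 1 -> (chart i @` dom i) (p + t *: (q - p))) ->
  0 <= t <= 1 ->
  speed M (chart_segment i p q) t = chart_norm i (p + t *: (q - p)) (q - p).
Proof.
move=> pqi t01; have it := pqi t t01.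
have cE : \forall s \near t, p + s *: (q - p) = (chart i \o chart_segment i p q) s.
  have : \forall s \near t, (chart i @` dom i) (p + s *: (q - p)).
    apply: (line_continuous (p := p) (v := q - p)).
    by apply: open_nbhs_nbhs; split => //; exact: chart_open.
  by apply: filterS => s /chart_invK[_ <-].
have [dit zt] := chart_invK it.
have := near_eq_is_derive cE (line_is_derive p (q - p) t) => -[dc zv].
rewrite (@speedE _ _ _ _ _ _ i)//; last first.
  by have [] := chart_segment_C1 pqi t01.
by rewrite derive1E zv /chart_segment zt.
Qed.

Lemma riemannian_dist_le_segment i p q (K : R) :
  (forall t : R, 0 <= t <= 1 -> (chart i @` dom i) (p + t *: (q - p))) ->
  (forall t : R, 0 <= t <= 1 -> chart_norm i (p + t *: (q - p)) (q - p) <= K) ->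
  (riemannian_dist M (chart_inv i p) (chart_inv i q) <= K%:E)%E.
Proof.
move=> pqi pqK; have c1 := chart_segment_C1 pqi.
apply: (@le_trans _ _ (curve_length M (chart_segment i p q))); last first.
  by apply: curve_length_le => // t t01; rewrite chart_segment_speed ?pqK.
apply: ereal_inf_lbound; exists [:: chart_segment i p q].
  by split=> //=; rewrite /chart_segment ?scale0r ?addr0 ?scale1r ?subrKC.
by rewrite big_cons big_nil adde0.
Qed.

(** Close to [p] the Gram matrix changes little, so the length of a straight segment hardly exceeds
    its norm at [p]; balls are convex, so the segment stays where this estimate holds. *)
Lemma chart_dist_le i p (e : R) : (chart i @` dom i) p -> 0 < e ->
  \forall r \near 0^'+, forall q q', ball p r q -> ball p r q' ->
    (chart i @` dom i) q /\
    (riemannian_dist M (chart_inv i q) (chart_inv i q') <=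
      (chart_norm i p (q' - q) + e * `|q' - q|)%:E)%E.
Proof.
move=> ip e0.
have : \forall z \near p, (chart i @` dom i) z.
  by apply: open_nbhs_nbhs; split => //; exact: chart_open.
(* By [inner_le_norm], this tolerance changes the squared norm of [v] by at most [e ^+ 2] times its
   squared coordinate norm; [+ 1] keeps the denominator positive when [m = 0]. *)
have : \forall z \near p, `|gram i p - gram i z| < e ^+ 2 / (m%:R ^+ 2 + 1).
  have m0 : 0 < m%:R ^+ 2 + 1 :> R by rewrite ltr_wpDl// sqr_ge0.
  have e20 : 0 < e ^+ 2 / (m%:R ^+ 2 + 1) by rewrite divr_gt0// exprn_gt0.
  by move: (gram_cvg ip) => /cvgrPdist_lt /(_ _ e20).
move=> gz iz; have : \forall z \near p,
    `|gram i p - gram i z| < e ^+ 2 / (m%:R ^+ 2 + 1) /\ (chart i @` dom i) z.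
  by apply: filterS2 gz iz.
move=> /nbhs_ballP[r0 /= r00 {iz gz}gz].
near=> r; have rr0 : r < r0 by near: r; exact: nbhs_right_lt.
move=> q q' pq pq'; have seg t : 0 <= t <= 1 -> ball p r0 (q + t *: (q' - q)).
  move=> /andP[t0 t1]; apply: (@le_ball _ _ p r) => //; first exact: ltW.
  move: pq pq'; rewrite -ball_normE/= => pq pq'.
  have -> : p - (q + t *: (q' - q)) = (1 - t) *: (p - q) + t *: (p - q').
    by apply/rowP => a; rewrite !mxE; ring.
  apply: le_lt_trans (ler_normD _ _) _; rewrite !normrZ !ger0_norm ?subr_ge0//.
  have [->|t0'] := eqVneq t 0; first by rewrite mul0r addr0 subr0 mul1r.
  have {t0'} : 0 < t by rewrite lt_neqAle eq_sym t0'.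
  by move: pq pq'; nra.
split.
  have := seg 0; rewrite lexx ler01 scale0r addr0 => /(_ isT) qr0.
  exact: (gz _ qr0).2.
apply: riemannian_dist_le_segment => t /seg /gz[gt it] //.
rewrite {1}/chart_norm; set v := q' - q.
have cn0 : 0 <= chart_norm i p v by exact: sqrtr_ge0.
rewrite -[leRHS](ger0_norm (addr_ge0 cn0 _)) ?mulr_ge0 ?(ltW e0)//.
rewrite -sqrtr_sqr ler_wsqrtr//.
have [v0|v0] := eqVneq v 0.
  by rewrite v0 inner0 sqr_ge0.
have ip0 : 0 < inner (gram i p) v v by exact: gram_posdef.
have cn2 : chart_norm i p v ^+ 2 = inner (gram i p) v v by rewrite sqr_sqrtr// ltW.
have := inner_le_norm (gram i p - gram i (q + t *: v)) v.
rewrite innerB => /ler_normlP[+ _]; rewrite opprB => gv.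
have : m%:R ^+ 2 * `|gram i p - gram i (q + t *: v)| * `|v| ^+ 2 <=
    e ^+ 2 * `|v| ^+ 2.
  rewrite ler_wpM2r ?sqr_ge0//.
  have m0 : 0 <= m%:R ^+ 2 :> R by rewrite sqr_ge0.
  move: gt; rewrite ltr_pdivlMr ?ltr_wpDl// => gt.
  apply: le_trans (ltW gt); rewrite mulrC ler_wpM2l// lerDl ler01.
  by [].
(* Half the cross term of the square: a sum of squares is at most the square of the sum. *)
have : 0 <= chart_norm i p v * (e * `|v|) by rewrite mulr_ge0// mulr_ge0// ltW.
by rewrite sqrrD exprMn cn2 -mulr_natl; lra.
Unshelve. all: by end_near. Qed.

End segments.

(** * Differentiable maps are Lipschitz *)

Section tangent_maps.
Variables (R : realType) (m : nat) (X : topologicalType).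
Variables (M : riemannian_manifold R m X) (f : X -> X).

Lemma tangent_norm_coercive x : exists2 C : R, 0 <= C &
  forall v, `|v| <= C * tangent_norm M x v.
Proof.
apply: inner_coercive => v v0; apply: gram_posdef v0.
by exists x => //; exact: chart_at_dom.
Qed.

Lemma linear_rV_bounded (A : {linear 'rV[R]_m -> 'rV[R]_m}) :
  exists2 C : R, 0 <= C & forall v, `|A v| <= C * `|v|.
Proof.
exists (\sum_(i < m) `|A (delta_mx 0 i)|) => [|v]; first exact: sumr_ge0.
rewrite [in leLHS](row_sum_delta v) linear_sum mulr_suml.
apply: le_trans (ler_norm_sum _ _ _) _; apply: ler_sum => i _.
by rewrite linearZ normrZ mulrC ler_wpM2l// entry_le_norm.
Qed.

(** This gives [sup] its meaning: coercivity bounds the coordinates of the vectors of norm at most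
    1, and a linear map is bounded on them. *)
Lemma tangent_map_norm_has_sup x :
  has_sup [set tangent_norm M (f x) (tangent_map M f x v)
          | v in [set v | tangent_norm M x v <= 1]].
Proof.
split.
  exists (tangent_norm M (f x) (tangent_map M f x 0)); exists 0 => //.
  by rewrite /= /tangent_norm inner0 sqrtr0.
have [C C0 xC] := tangent_norm_coercive x.
have [A A0 fA] := linear_rV_bounded (tangent_map M f x).
set g := gram (chart_at M (f x)) (chart (chart_at M (f x)) (f x)).
exists (Num.sqrt (m%:R ^+ 2 * `|g| * (A * C) ^+ 2)) => _ [v /= v1 <-].
apply: ler_wsqrtr; apply: le_trans (ler_norm _) _.
apply: le_trans (inner_le_norm _ _) _.
rewrite ler_wpM2l ?mulr_ge0 ?sqr_ge0// ler_sqr ?nnegrE ?mulr_ge0//.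
apply: le_trans (fA v) _; rewrite ler_wpM2l//.
by apply: le_trans (xC v) _; rewrite ler_piMr.
Qed.

Lemma tangent_map_norm_le x v :
  tangent_norm M (f x) (tangent_map M f x v) <=
  tangent_map_norm M f x * tangent_norm M x v.
Proof.
have [->|v0] := eqVneq v 0.
  by rewrite /tangent_map linear0 /tangent_norm !inner0 sqrtr0 mulr0.
have n0 : 0 < tangent_norm M x v.
  rewrite sqrtr_gt0; apply: gram_posdef v0.
  by exists x => //; exact: chart_at_dom.
have : tangent_norm M (f x) (tangent_map M f x ((tangent_norm M x v)^-1 *: v)) <=
    tangent_map_norm M f x.
  apply: sup_ubound; first exact: (tangent_map_norm_has_sup x).2.
  exists ((tangent_norm M x v)^-1 *: v) => //=.
  rewrite [leLHS]chart_normZ ger0_norm ?invr_ge0 ?(ltW n0)//.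
  by rewrite mulVf// gt_eqF.
rewrite /tangent_map linearZ [leLHS]chart_normZ ger0_norm ?invr_ge0 ?(ltW n0)//.
by rewrite mulrC ler_pdivrMr.
Qed.

End tangent_maps.

Section lipschitz.
Variables (R : realType) (m : nat) (X : metricType R).
Variables (M : riemannian_manifold R m X) (f : X -> X) (L : R).
Hypothesis mdistE : forall x y : X, (mdist x y)%:E = riemannian_dist M x y.
Hypothesis diff_f : differentiable_map M f.
Hypothesis f_le : forall x, tangent_map_norm M f x <= L.
Hypothesis L_gt0 : 0 < L.

(** The image [f \o c] need not be C^1, so its length is avoided: the distance from [f (c 0)] is
    compared directly with [L * V], where [V] is an antiderivative of the speed. *)
Lemma curve_image_dist_le (c : R -> X) : C1_curve M c ->
  ((mdist (f (c 0)) (f (c 1)))%:E <= L%:E * curve_length M c)%E.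
Proof.
move=> c1; have [V [dV ->]] := curve_lengthE c1; have L_ge0 := ltW L_gt0.
rewrite -EFinM lee_fin mulrBr.
pose h t := mdist (f (c 0)) (f (c t)) - L * V t.
suff : h 1 <= h 0 by rewrite /h mdistxx; lra.
have fc t : 0 <= t <= 1 -> {for t, continuous (f \o c)}.
  by move=> /c1[ct _]; apply: continuous_comp => //; have [] := diff_f (c t).
apply: increment_le0_le => [t t01|t e t01 e0].
  apply: continuousB.
    have := @continuous_comp _ _ _ (f \o c) (mdist (f (c 0))) t (fc t t01).
    by apply; exact: mdist_continuous.
  apply: continuousM; first exact: cst_continuous.
  have [dVt _] := dV t t01.
  exact/differentiable_continuous/derivable1_diffP.
set x := c t; set y := f x; set j := chart_at M y.
have t01' : 0 <= t <= 1 by case/andP: t01 => -> /ltW.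
have [ct _] := c1 t t01'.
have [fx dphi] := diff_f x.
set i := chart_at M x in dphi.
have it : dom i (c t) by exact: chart_at_dom.
have jt : dom j (f (c t)) by exact: chart_at_dom.
have [_ _ dg] := nbhs_singleton (C1_curve_near c1 t01' it).
set u := derive1 (chart i \o c) t; pose w := tangent_map M f x u.
pose psi s := chart j (f (c s)).
(* Chain rule in the charts at [c t] and [f (c t)]; it uses differentiability of [f] at the point
   [c t] alone. *)
have dpsi : is_derive t (1 : R) psi w.
  have psiE : \forall s \near t, (in_charts M f x \o (chart i \o c)) s = psi s.
    apply: filterS (near_dom ct it) => s ds.
    by rewrite /in_charts /psi/= chartK.
  apply: (near_eq_is_derive psiE).
  have dg' : differentiable (chart i \o c) t by exact/derivable1_diffP.
  have dc : differentiable (in_charts M f x \o (chart i \o c)) t.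
    exact: differentiable_comp.
  apply: DeriveDef; first exact/derivable1_diffP.
  by rewrite (deriveE _ dc) diff_comp//= /w /u derive1E (deriveE _ dg').
have w_le : chart_norm j (psi t) w <= L * speed M c t.
  apply: le_trans (tangent_map_norm_le M f x u) _.
  by rewrite ler_wpM2r ?sqrtr_ge0.
(* Three errors occur below: [g] from the norm of the difference quotient, [g] times the norm of [w]
   plus 1 from [chart_dist_le], and [L * g] from the growth of [V]. They add up to [g * K <= e]. *)
pose K := `|w| + 2 + L; have K0 : 0 < K by rewrite /K; have := normr_ge0 w; lra.
pose g := Num.min (e / K) 1.
have g0 : 0 < g by rewrite lt_min divr_gt0// ltr01.
have gK : g * K <= e by rewrite -ler_pdivlMr// ge_min lexx.
have g1 : g <= 1 by rewrite ge_min lexx orbT.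
have jpsi : (chart j @` dom j) (psi t) by exists (f (c t)).
have [r [r0 rj]] : exists r : R, 0 < r /\
    forall q q', ball (psi t) r q -> ball (psi t) r q' ->
    (chart j @` dom j) q /\
    (riemannian_dist M (chart_inv j q) (chart_inv j q') <=
      (chart_norm j (psi t) (q' - q) + g * `|q' - q|)%:E)%E.
  near (0 : R)^'+ => r; exists r; split; near: r; first exact: nbhs_right_gt.
  exact: chart_dist_le jpsi g0.
have psic : {for t, continuous psi}.
  have [dpsi1 _] := dpsi; exact/differentiable_continuous/derivable1_diffP.
have qpsi := difference_quotient_cvg dpsi.
have qV := difference_quotient_cvg (dV t t01').
have qn : chart_norm j (psi t) ((s - t)^-1 *: (psi s - psi t)) @[s --> t^'+] -->
    chart_norm j (psi t) w.
  have := @chart_norm_cvg _ _ _ M _ (t^'+) _ j (fun=> psi t) _ _ _ jpsi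
    (cvg_cst _) qpsi.
  by apply.
near=> s.
have ts : t < s by near: s; exact: nbhs_right_gt.
have st0 : 0 < s - t by rewrite subr_gt0.
have rs : ball (psi t) r (psi s).
  near: s; rewrite near_withinE; have : \forall s \near t, ball (psi t) r (psi s).
    by apply: psic; exact: nbhsx_ballx.
  by apply: filterS.
have js : dom j (f (c s)).
  near: s; rewrite near_withinE; have : \forall s \near t, dom j (f (c s)).
    by apply: (fc t t01'); apply: open_nbhs_nbhs; split => //; exact: dom_open.
  by apply: filterS.
set Q := (s - t)^-1 *: (psi s - psi t).
have QE : psi s - psi t = (s - t) *: Q by rewrite /Q scalerA mulfV ?scale1r// gt_eqF.
have Qn : `|Q| <= `|w| + 1.
  have : `|w - Q| <= g by rewrite /Q; near: s; move/cvgrPdist_le : qpsi; apply.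
  move=> wQ; rewrite -[Q](subrK w) addrC; apply: le_trans (ler_normD _ _) _.
  by rewrite lerD2l distrC (le_trans wQ).
have Qw : chart_norm j (psi t) Q <= chart_norm j (psi t) w + g.
  rewrite -lerBlDl.
  apply: le_trans (ler_norm _) _; rewrite distrC /Q; near: s.
  by move/cvgrPdist_le : qn; apply.
have Vs : (speed M c t - g) * (s - t) <= V s - V t.
  rewrite -ler_pdivlMr// mulrC lerBlDr -lerBlDl.
  apply: le_trans (ler_norm _) _; near: s; move/cvgrPdist_le : qV; exact.
have md : mdist (f (c t)) (f (c s)) <= (s - t) * (chart_norm j (psi t) Q + g * `|Q|).
  have [_] := rj _ _ (ballxx _ r0) rs.
  rewrite /psi !chartK// -mdistE lee_fin -/(psi s) -/(psi t) QE => /le_trans; apply.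
  by rewrite chart_normZ normrZ gtr0_norm// mulrDr lerD2l mulrCA.
have tri := metric_triangle (f (c 0)) (f (c t)) (f (c s)).
have lem : chart_norm j (psi t) Q + g * `|Q| <= L * speed M c t + g * (`|w| + 2).
  by move: Qw w_le (ler_wpM2l (ltW g0) Qn); lra.
have := ler_wpM2l (ltW st0) lem; have := ler_wpM2l L_ge0 Vs.
have := ler_wpM2l (ltW st0) gK.
move: tri md; rewrite /h /K -/x; lra.
Unshelve. all: by end_near. Qed.

(** The pieces of a path add up by the triangle inequality; dividing by [L > 0] then allows passing
    to the infimum over paths. *)
Lemma differentiable_map_lipschitz : lipschitz_with L f.
Proof.
move=> x y.
have path s a b : piecewise_C1_path M s a b ->
    ((mdist (f a) (f b))%:E <= L%:E * (\sum_(c <- s) curve_length M c))%E.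
  elim: s a => [|c s IH] a /=; first by move=> ->; rewrite mdistxx big_nil mule0.
  move=> [c1 <- /IH bs]; rewrite big_cons ge0_muleDr ?curve_length_ge0//; last first.
    by apply: sume_ge0 => d _; exact: curve_length_ge0.
  apply: le_trans (leeD (curve_image_dist_le c1) bs).
  by rewrite -EFinD lee_fin metric_triangle.
rewrite -lee_fin EFinM (mdistE x y) -lee_pdivrMl//.
apply: le_ereal_inf_tmp => _ [s xy <-].
by rewrite lee_pdivrMl // path.
Qed.

End lipschitz.

(** * Ball dimension of a manifold *)

(* If [P [set: X]] failed, the complements of the sets satisfying [P] would
   form a proper filter without cluster point. *)
Lemma compact_ind (X : topologicalType) (P : set X -> Prop) :
  compact [set: X] -> P set0 ->
  (forall A B, A `<=` B -> P B -> P A) ->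
  (forall A B, P A -> P B -> P (A `|` B)) ->
  (forall x : X, exists2 W, nbhs x W & P W) ->
  P [set: X].
Proof.
move=> cX P0 Psub PU Ploc; apply: contrapT => nP.
pose F := [set A | P (~` A)].
have FF : ProperFilter F.
  apply: Build_ProperFilter_ex.
    move=> A FA; apply: contrapT => /set0P/negP/negPn/eqP A0.
    by apply: nP; move: FA; rewrite /F/= A0 setC0.
  split => [|A B FA FB|A B AB].
  - by rewrite /F/= setCT.
  - by have := PU _ _ FA FB; rewrite -setCI.
  - by apply: Psub; exact: subsetC.
have [|x [_ xF]] := cX F FF; first by rewrite /F/= setCT.
have [W xW PW] := Ploc x.
have [||y [nWy Wy]] := xF (~` W) W => //; first by rewrite /F/= setCK.
Qed.

Section ball_dimension_manifold.
Variables (R : realType) (m : nat) (X : metricType R).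

(** Pieces are again fibres of a code, so that no centres have to be found when passing to subsets
    and unions. The exponent [m] is what bounds the dimension. *)
Definition polynomially_covered (W : set X) : Prop := exists2 A : R, 0 <= A &
  forall e, 0 < e -> e < 1 -> exists (J : finType) (c : X -> J),
    #|J|%:R <= A * e^-1 ^+ m /\
    forall x y, W x -> W y -> c x = c y -> mdist x y < e.

Lemma polynomially_covered0 : polynomially_covered set0.
Proof.
exists 1 => // e e0 e1; exists unit, (fun=> tt); split => //.
by rewrite card_unit mul1r exprn_ege1// invf_ge1// ltW.
Qed.

Lemma polynomially_coveredU W1 W2 : polynomially_covered W1 ->
  polynomially_covered W2 -> polynomially_covered (W1 `|` W2).
Proof.
move=> [A1 A10 W1P] [A2 A20 W2P]; exists (A1 + A2) => [|e e0 e1].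
  exact: addr_ge0.
have [J1 [c1 [J1A c1P]]] := W1P e e0 e1; have [J2 [c2 [J2A c2P]]] := W2P e e0 e1.
exists (J1 + J2)%type, (fun x => if `[< W1 x >] then inl (c1 x) else inr (c2 x)).
rewrite card_sum natrD mulrDl lerD//; split => // x y.
case: asboolP => W1x; case: asboolP => W1y // Wx Wy [].
  exact: c1P.
by case: Wx => // W2x; case: Wy => // W2y; exact: c2P.
Qed.

(** A cubic grid in the coordinates has of the order of [e^-1 ^+ m] cells, and the second estimate
    turns small cells into small pieces of [W]. *)
Lemma polynomially_covered_chart (W : set X) (kappa : X -> 'rV[R]_m) (p : 'rV[R]_m)
    (r C : R) : 0 < r -> 0 < C ->
  (forall x, W x -> `|p - kappa x| < r) ->
  (forall x y, W x -> W y -> mdist x y <= C * `|kappa x - kappa y|) ->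
  polynomially_covered W.
Proof.
move=> r0 C0 Wr WC; exists ((2 * r * C + 1) ^+ m) => [|e e0 e1].
  by rewrite exprn_ge0// addr_ge0// !mulr_ge0// ltW.
(* a grid of mesh 2 r / (N + 1) < e / C on the ball of radius r *)
pose N := Num.truncn (2 * r * C / e); pose cell (x : R) := x * N.+1%:R / (2 * r).
have r2 : 0 < 2 * r by rewrite mulr_gt0.
have D0 : 0 <= 2 * r * C / e by rewrite !mulr_ge0// ?invr_ge0// ltW.
have NP : 2 * r * C / e < N.+1%:R by exact: truncnS_gt.
have N0 : 0 < N.+1%:R :> R by rewrite ltr0n.
pose c (x : X) : {ffun 'I_m -> 'I_N.+1} :=
  [ffun j => inord (Num.truncn (cell (kappa x 0 j - p 0 j + r)))].
(* From [N <= 2 * r * C / e] and [1 <= e^-1] follows [N.+1 <= (2 * r * C + 1) / e]. *)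
exists {ffun 'I_m -> 'I_N.+1}, c; split.
  rewrite card_ffun !card_ord natrX -exprMn.
  rewrite lerXn2r ?nnegrE ?mulr_ge0 ?invr_ge0 ?(ltW e0)//.
    by rewrite addr_ge0// !mulr_ge0// ltW.
  rewrite -natr1 mulrDl mul1r lerD// ?invf_ge1 ?(ltW e1)//.
  by have /andP[] := truncn_itv D0.
(* Adding [r] moves the coordinates between 0 and [2 * r], so truncation is the integer part and
   [inord] loses nothing. *)
have cellP x j : W x -> exists2 n : nat, (c x j : nat) = n &
    n%:R <= cell (kappa x 0 j - p 0 j + r) < n.+1%:R.
  move=> /Wr xr; have {xr} : `|(p - kappa x) 0 j| < r.
    by apply: le_lt_trans xr; exact: entry_le_norm.
  rewrite !mxE => /ltr_normlP[k1 k2].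
  set z := kappa x 0 j - p 0 j + r; have z0 : 0 <= z by rewrite /z; lra.
  have cz0 : 0 <= cell z by rewrite /cell !mulr_ge0 ?invr_ge0 ?(ltW r2).
  exists (Num.truncn (cell z)); last exact: truncn_itv.
  rewrite ffunE inordK// -(ltr_nat R).
  have /andP[/le_lt_trans + _] := truncn_itv cz0; apply.
  rewrite /cell ltr_pdivrMr// mulrC ltr_pM2l//; rewrite /z; lra.
move=> x y Wx Wy cxy; apply: le_lt_trans (WC x y Wx Wy) _.
apply: (@le_lt_trans _ _ (C * (2 * r / N.+1%:R))); last first.
  by rewrite mulrA ltr_pdivrMr//; move: NP; rewrite ltr_pdivrMr//; lra.
rewrite ler_pM2l// [leLHS]mx_normrE.
apply: bigmax_le => [|[i j] _]; first by rewrite divr_ge0// ltW.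
rewrite /= (ord1 i) !mxE.
have [n cx /andP[x1 x2]] := cellP x j Wx; have [n' cy /andP[y1 y2]] := cellP y j Wy.
have nn : n' = n by rewrite -cx -cy cxy.
rewrite nn in y1 y2; move: x1 x2 y1 y2; rewrite /cell.
rewrite !ler_pdivlMr// !ltr_pdivrMr// -(natr1 n) => x1 x2 y1 y2.
rewrite -[X in _ * X](gtr0_norm N0) -normrM ler_norml.
by apply/andP; split; nra.
Qed.

End ball_dimension_manifold.

Section manifold_dimension.
Variables (R : realType) (m : nat) (X : metricType R).
Variables (M : riemannian_manifold R m X).
Hypothesis cX : compact [set: X].
Hypothesis mdistE : forall x y : X, (mdist x y)%:E = riemannian_dist M x y.

(** Compactness reduces the claim to a small neighbourhood of a point, where [chart_dist_le] bounds
    the distance by a multiple of the coordinate distance. *)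
Lemma manifold_polynomially_covered : polynomially_covered m [set: X].
Proof.
apply: compact_ind cX (polynomially_covered0 _ _) _ _ _.
- move=> A B AB [a a0 Ba]; exists a => // e e0 e1.
  have [J [c [JA cP]]] := Ba e e0 e1; exists J, c; split => // x y Ax Ay.
  by apply: cP; exact: AB.
- exact: polynomially_coveredU.
move=> x; set i := chart_at M x; set p := chart i x.
have ix : dom i x by exact: chart_at_dom.
have ip : (chart i @` dom i) p by exists x.
have [r r0 rP] : exists2 r : R, 0 < r & forall q q', ball p r q -> ball p r q' ->
    (chart i @` dom i) q /\
    (riemannian_dist M (chart_inv i q) (chart_inv i q') <=
      (chart_norm i p (q' - q) + 1 * `|q' - q|)%:E)%E.
  near (0 : R)^'+ => r; exists r; near: r; first exact: nbhs_right_gt.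
  exact: chart_dist_le ip ltr01.
exists (dom i `&` (chart i @^-1` ball p r)).
  apply: filterI; first by apply: open_nbhs_nbhs; split => //; exact: dom_open.
  by apply: (chart_continuous ix); exact: nbhsx_ballx.
(* The root bounds [chart_norm i p] through [inner_le_norm]; the [1] is the tolerance taken in
   [chart_dist_le]. *)
pose C := Num.sqrt (m%:R ^+ 2 * `|gram i p|) + 1.
apply: (@polynomially_covered_chart _ _ _ _ (chart i) p r C) => //.
- by rewrite ltr_wpDl// sqrtr_ge0.
- by move=> y [_]; rewrite /= -ball_normE.
move=> y z [iy py] [iz pz]; have [_] := rP _ _ pz py.
rewrite !chartK// -mdistE metric_sym lee_fin => /le_trans; apply.
rewrite /C mulrDl lerD2r /chart_norm -[`|_ - _|](ger0_norm (normr_ge0 _)) -sqrtr_sqr.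
rewrite -sqrtrM ?mulr_ge0 ?sqr_ge0// ler_wsqrtr//.
exact: le_trans (ler_norm _) (inner_le_norm _ _).
Unshelve. all: by end_near. Qed.

Lemma manifold_ball_dimension_le : (ball_dimension X <= m%:R%:E)%E.
Proof.
have [A0 A00 XA] := manifold_polynomially_covered.
pose A := A0 + 1; have A_gt0 : 0 < A by rewrite ltr_wpDl.
apply: limf_esup_le_fin => g g0; near=> e.
have e0 : 0 < e by near: e; exact: nbhs_right_gt.
have e1 : e < 1 by near: e; apply: nbhs_right_lt.
(* This makes [ln A] smaller than [g * - ln e], so the factor [A] costs less than [g] in the
   quotient. *)
have eA : e < expR (- (ln A / g)) by near: e; apply: nbhs_right_lt; exact: expR_gt0.
have lne0 : ln e < 0 by rewrite ln_lt0// e0.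
have lneA : ln e < - (ln A / g) by rewrite -[ltRHS]expRK ltr_ln ?posrE ?expR_gt0.
have ln0 : 0 < `|ln e| by rewrite normr_gt0 lt_eqF.
have [J [c [JA cP]]] := XA e e0 e1.
rewrite /= inver gt_eqF// lee_pdivrMr//.
have Ae0 : 0 < A * e^-1 ^+ m by rewrite mulr_gt0// exprn_gt0// invr_gt0.
apply: (@le_trans _ _ (lne (A * e^-1 ^+ m)%:E)).
  rewrite lee_lne ?in_itv/= ?covering_number_ge0 ?leey ?lee_fin ?(ltW Ae0)//.
  apply: le_trans (covering_number_le_code (c := c) _) _.
    by move=> x y; exact: cP.
  rewrite lee_fin (le_trans JA)// ler_wpM2r ?exprn_ge0 ?invr_ge0 ?(ltW e0)//.
  by rewrite lerDl.
rewrite lne_EFin// -EFinM lee_fin lnM ?posrE ?exprn_gt0 ?invr_gt0// lnXn ?invr_gt0//.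
rewrite lnV ?posrE// ltr0_norm// -mulr_natl.
have : ln A <= g * - ln e.
  by rewrite mulrC -ler_pdivrMr// lerNr ltW.
lra.
Unshelve. all: by end_near. Qed.

End manifold_dimension.

(** * Norms of differentials and the two inequalities *)

Lemma tangent_map_norm_ge0 (R : realType) (m : nat) (X : topologicalType)
    (M : riemannian_manifold R m X) (f : X -> X) (x : X) :
  0 <= tangent_map_norm M f x.
Proof.
apply: sup_ubound; first exact: (tangent_map_norm_has_sup M f x).2.
exists 0; first by rewrite /= /tangent_norm inner0 sqrtr0.
by rewrite /tangent_map linear0 /tangent_norm inner0 sqrtr0.
Qed.

Lemma tangent_map_norm_le_root (R : realType) (m : nat) (X : topologicalType)
    (M : riemannian_manifold R m X) (f : X -> X) (x : X) (a : R) : 1 <= a ->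
  tangent_map_norm M f x ^+ m <= a -> tangent_map_norm M f x <= a `^ m%:R^-1.
Proof.
move=> a1; have t0 := tangent_map_norm_ge0 M f x.
case: m M t0 => [|m] M t0 ta.
  (* For [m = 0] the exponent is the inverse of 0, that is 0, so the bound is 1; all tangent vectors
     vanish. *)
  rewrite invr0 powRr0; apply: sup_le_ub.
    exact: (tangent_map_norm_has_sup M f x).1.
  move=> _ [v _ <-]; rewrite [tangent_map M f x v]thinmx0.
  by rewrite /tangent_norm inner0 sqrtr0.
have a0 : 0 <= a by rewrite (le_trans ler01).
have -> : tangent_map_norm M f x = (tangent_map_norm M f x ^+ m.+1) `^ m.+1%:R^-1.
  by rewrite -powR_mulrn// -powRrM mulfV// powRr1.
by apply: ge0_ler_powR; rewrite ?nnegrE ?invr_ge0 ?exprn_ge0.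
Qed.

Theorem proposition2p4 (R : realType) (k : nat) (X : metricType R)
    (T : {ffun 'I_k -> nat} -> X -> X) :
  (2 <= k)%N ->
  compact [set: X] ->
  continuous_action T ->
  (forall L : 'I_k -> R,
     (ball_dimension X < +oo)%E ->
     (forall i, lipschitz_with (L i) (generator T i)) ->
     (friedland_entropy T <=
       (ln (\sum_(i < k) Num.max 1 (L i) `^ fine (ball_dimension X)))%:E)%E)
  /\
  (forall (m : nat) (M : riemannian_manifold R m X),
     (forall x y : X, (mdist x y)%:E = riemannian_dist M x y) ->
     (forall i, differentiable_map M (generator T i)) ->
     (friedland_entropy T <=
       lne (\sum_(i < k)
         maxe 1 (ereal_sup
           [set (tangent_map_norm M (generator T i) x ^+ m)%:E
             | x in [set: X]])))%E).
Proof.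
move=> k2 cX _; have k0 : (0 < k)%N by exact: ltnW.
split=> [L Dfin TL|m M mdistE dT].
  apply: friedland_entropy_le => // i; first by rewrite le_max lexx.
  move=> x y; apply: le_trans (TL i x y) _.
  by rewrite ler_wpM2r ?mdist_ge0// le_max lexx orbT.
pose S i : \bar R := (maxe 1 (ereal_sup
  [set (tangent_map_norm M (generator T i) x ^+ m)%:E | x in [set: X]]))%E.
rewrite (eq_bigr S)//; have S1 i : (1%:E <= S i)%E by rewrite /S le_max lexx.
have S0 i : (0 <= S i)%E by rewrite (le_trans _ (S1 i))// lee_fin.
(* An infinite supremum makes the right-hand side [+oo]. *)
have [[i Si]|Sfin] := pselect (exists i, S i = +oo%E).
  rewrite (bigD1 i)//= [S i]Si addye ?leey//.
  by rewrite gt_eqF// (lt_le_trans (ltNyr 0))// sume_ge0.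
pose a i := fine (S i).
have aE i : S i = (a i)%:E.
  rewrite /a fineK// ge0_fin_numE// ltey; apply/eqP => Si; apply: Sfin; by exists i.
have a1 i : 1 <= a i by rewrite -lee_fin -aE.
(* The root makes [L i] a Lipschitz constant that is at least 1 and whose [m]-th power does not
   exceed [a i]. *)
pose L i := a i `^ m%:R^-1.
have L1 i : 1 <= L i.
  apply: (@le_trans _ _ (1 `^ m%:R^-1)); first by rewrite powR1.
  apply: ge0_ler_powR => //; rewrite ?nnegrE ?invr_ge0//.
  exact: le_trans ler01 (a1 i).
have TL i : lipschitz_with (L i) (generator T i).
  apply: (differentiable_map_lipschitz mdistE (dT i)) => [x|]; last first.
    exact: lt_le_trans ltr01 (L1 i).
  apply: tangent_map_norm_le_root => //; rewrite -lee_fin -aE /S le_max.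
  by rewrite [X in _ || X]ereal_sup_ubound ?orbT//; exists x.
have Dm := manifold_ball_dimension_le cX mdistE.
have Dfin : (ball_dimension X < +oo)%E by apply: le_lt_trans Dm (ltry _).
have Dm' : fine (ball_dimension X) <= m%:R.
  by case: (ball_dimension X) Dm Dfin => [r| |].
apply: le_trans (friedland_entropy_le k0 cX L1 TL Dfin) _.
under eq_bigr do rewrite aE; rewrite sumEFin.
have a0 i : 0 <= a i by exact: le_trans ler01 (a1 i).
have sum_gt0 (F : 'I_k -> R) : (forall i, 1 <= F i) -> 0 < \sum_(i < k) F i.
  move=> F1; rewrite (bigD1 (Ordinal k0))//= ltr_pwDl ?(lt_le_trans ltr01)//.
  by apply: sumr_ge0 => i _; exact: le_trans ler01 (F1 i).
rewrite lne_EFin ?sum_gt0// lee_fin ler_ln ?posrE ?(sum_powR_gt0 k0 L1) ?sum_gt0//.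
(* Since [L i >= 1], the exponent may be raised from the ball dimension to [m]; the power is then
   [a i], or 1 if [m = 0]. *)
apply: ler_sum => i _; apply: (@le_trans _ _ (L i `^ m%:R)).
  exact: ler_powR.
rewrite /L -powRrM; case: (m) => [|n]; first by rewrite mulr0 powRr0.
by rewrite mulVf ?powRr1// pnatr_eq0.
Qed.
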